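(* Let $G$ be a finite group, let $V$ be a finite-dimensional $G$-module over $\mathbb{C}$ with character $\chi_V$, let $A$ be the adjacency matrix of the McKay quiver of $(G,V)$, and let $k\ge 0$ be an integer. Then: (i) For $\lambda\in\Lambda(G)$, the dimension of the irreducible module $Z_k^\lambda(G)$ for the centralizer algebra $Z_k(G)=\mathrm{End}_G(V^{\otimes k})$ is $$\dim Z_k^\lambda(G)=(A^k)_{0,\lambda}=|G|^{-1}\sum_{\mu\in\Lambda(G)}|\mathcal{C}_\mu|\,\chi_V(c_\mu)^k\,\overline{\chi_\lambda(c_\mu)}=|G|^{-1}\sum_{g\in G}\chi_V(g)^k\,\overline{\chi_\lambda(g)}.$$ (ii) The dimension of the space of $G$-invariants in $V^{\otimes k}$ is $$\dim (V^{\otimes k})^G=(A^k)_{0,0}=|G|^{-1}\sum_{\mu\in\Lambda(G)}|\mathcal{C}_\mu|\,\chi_V(c_\mu)^k=|G|^{-1}\sum_{g\in G}\chi_V(g)^k.$$ (iii) When $V$ is a self-dual $G$-module, $$\dim Z_k(G)=\dim Z_{2k}^0(G)=(A^{2k})_{0,0}=|G|^{-1}\sum_{\mu\in\Lambda(G)}|\mathcal{C}_\mu|\,\chi_V(c_\mu)^{2k}=|G|^{-1}\sum_{g\in G}\chi_V(g)^{2k}.$$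
   Context: $\Lambda(G)$ is a finite set indexing the irreducible complex $G$-modules $G_\lambda$ (with characters $\chi_\lambda$) up to isomorphism, and also the conjugacy classes of $G$; $0\in\Lambda(G)$ labels the trivial module. $c_\mu$ is a representative of the conjugacy class $\mathcal{C}_\mu$ labeled by $\mu$. The McKay quiver of $(G,V)$ is the directed multigraph with node set $\Lambda(G)$ having $a_{\nu,\lambda}$ arrows from $\nu$ to $\lambda$, where $a_{\nu,\lambda}$ is the multiplicity of $G_\lambda$ in $G_\nu\otimes V$; its adjacency matrix is $A=(a_{\nu,\lambda})$. The algebra $Z_k(G)=\mathrm{End}_G(V^{\otimes k})$ is semisimple, and its irreducible modules are labeled by those $\lambda\in\Lambda(G)$ for which $G_\lambda$ occurs in $V^{\otimes k}$: $Z_k^\lambda(G)$ is the irreducible module for which $V^{\otimes k}\cong\bigoplus_\lambda G_\lambda\otimes Z_k^\lambda(G)$ as a $(G,Z_k(G))$-bimodule (e.g. $Z_k^\lambda(G)\cong\mathrm{Hom}_G(G_\lambda,V^{\otimes k})$); $Z_k^\lambda(G)=0$ if $G_\lambda$ does not occur in $V^{\otimes k}$. *)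

(* Defs.v *)
From HB Require Import structures.
From mathcomp Require Import all_boot all_order all_algebra all_fingroup.
From mathcomp Require Import all_solvable all_field all_character.
From mathcomp Require Import complex.
From mathcomp Require Import reals.

Set Implicit Arguments.
Unset Strict Implicit.
Unset Printing Implicit Defensive.

Import GroupScope GRing.Theory Num.Theory.
Local Open Scope ring_scope.

(* A finite-dimensional G-module over F is a [representation F G], i.e. an    *)
(* [mx_representation F G n] bundled with its degree n >= 0. As in            *)
(* mxrepresentation, vectors are rows, and g acts by u |-> u *m V g.          *)

Section Modules.

Variables (F : fieldType) (gT : finGroupType) (G : {group gT}).
Implicit Types S U V W : representation F G.

Definition rchar V (g : gT) : F := \tr (V g).

Lemma triv_mx_repr : mx_repr G (fun _ : gT => 1%:M : 'M[F]_1).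
Proof. by split=> // x y _ _; rewrite mulmx1. Qed.

Definition triv_grepr : representation F G :=
  Representation (MxRepresentation triv_mx_repr).

Definition tens_grepr U V : representation F G :=
  Representation (prod_repr U V).

Fixpoint tpow_grepr V (k : nat) : representation F G :=
  if k is k'.+1 then tens_grepr (tpow_grepr V k') V else triv_grepr.

Lemma dual_mx_repr V : mx_repr G (fun g => (V g^-1%g)^T).
Proof.
split=> [|x y Gx Gy]; first by rewrite invg1 repr_mx1 trmx1.
by rewrite invMg repr_mxM ?groupV // trmx_mul.
Qed.

Definition dual_grepr V : representation F G :=
  Representation (MxRepresentation (dual_mx_repr V)).

Definition self_dual V : Prop := mx_rsim V (dual_grepr V).

(* Hom_G(U, W): X stands for the linear map u |-> u *m X, so that X *m Y is X *)
(* followed by Y.                                                             *)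
Definition homG U W : {vspace 'M[F]_(rdegree U, rdegree W)} :=
  (\bigcap_(g in G) lker (linfun (mulmx (U g)) - linfun (mulmxr (W g))))%VS.

Lemma homGP U W (X : 'M[F]_(rdegree U, rdegree W)) :
  reflect {in G, forall g, U g *m X = X *m W g} (X \in homG U W).
Proof.
have kerE g : (X \in lker (linfun (mulmx (U g)) - linfun (mulmxr (W g)))%VF)
              = (U g *m X == X *m W g).
  by rewrite memv_ker add_lfunE opp_lfunE !lfunE subr_eq0.
rewrite /homG memvE; apply: (iffP subv_bigcapP) => homX g Gg.
  by apply/eqP; rewrite -kerE memvE homX.
by rewrite -memvE kerE homX.
Qed.

Lemma homG_comp U V W X Y :
  X \in homG U V -> Y \in homG V W -> X *m Y \in homG U W.
Proof.
move=> /homGP homX /homGP homY; apply/homGP => g Gg.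
by rewrite mulmxA homX // -!mulmxA homY.
Qed.

(* Schur's lemma: the composition action of End_G(W) makes Hom_G(S, W) a      *)
(* simple module whenever it is nonzero.                                      *)
Lemma homG_simple S W X Y :
    [pchar F]^'.-group G -> mx_irreducible S ->
    X \in homG S W -> Y \in homG S W -> X != 0 ->
  exists2 Z, Z \in homG W W & Y = X *m Z.
Proof.
move=> F'G irrS /homGP homX /homGP homY nzX.
have freeX : row_free X.
  rewrite -kermx_eq0; apply: contraR nzX => nzK.
  have modK : mxmodule S (kermx X).
    apply/mxmoduleP => g Gg; apply/sub_kermxP.
    by rewrite -mulmxA homX // mulmxA mulmx_ker mul0mx.
  have [_ _ minS] := irrS.
  have /submxP[D D1] := minS _ modK (submx1 _) nzK.
  by rewrite -[X]mul1mx D1 -mulmxA mulmx_ker mulmx0.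
have [P XP1] := row_freeP freeX.
have nzG : #|G|%:R != 0 :> F by rewrite natf_neq0_pchar.
pose Z0 := \sum_(g in G) W g *m (P *m Y) *m W g^-1%g.
have Z0P : {in G, forall g, W g *m Z0 = Z0 *m W g}.
  move=> h Gh; rewrite mulmx_sumr mulmx_suml.
  rewrite [RHS](reindex_inj (mulgI h)) /=; apply: eq_big => [g|g Gg].
    by rewrite groupMl.
  by rewrite invMg !repr_mxM ?groupV // !mulmxA repr_mxKV.
exists (#|G|%:R^-1 *: Z0).
  by apply/homGP => g Gg; rewrite -scalemxAr -scalemxAl Z0P.
rewrite -scalemxAr mulmx_sumr (eq_bigr (fun=> Y)) => [|g Gg].
  by rewrite sumr_const -scaler_nat scalerA mulVf ?scale1r.
rewrite !mulmxA -homX // -[_ *m P]mulmxA XP1 mulmx1 -mulmxA -homY ?groupV //.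
by rewrite mulmxA -repr_mxM ?groupV // mulgV repr_mx1 mul1mx.
Qed.

(* The centralizer algebra Z_k(G) = End_G(V^{(x)k}), with product *m.         *)
Definition Zk V (k : nat) := homG (tpow_grepr V k) (tpow_grepr V k).

End Modules.

Section IrreducibleModules.

Variables (F : fieldType) (gT : finGroupType) (G : {group gT}).
Variable sG : irrType F G.

Definition irr_grepr (i : sG) : representation F G :=
  Representation (irr_repr i).

(* Z_k^i(G) = Hom_G(G_i, V^{(x)k}), on which Z_k(G) acts by composition       *)
(* ([homG_comp]); it is simple or zero by [homG_simple].                      *)
Definition Zk_irr V (k : nat) (i : sG) := homG (irr_grepr i) (tpow_grepr V k).

End IrreducibleModules.

Section McKay.

Variables (F : decFieldType) (gT : finGroupType) (G : {group gT}).
Variable sG : irrType F G.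
Implicit Types V W : representation F G.

(* Multiplicity of G_i in W. The sum has at most one term: M ranges over the  *)
(* isotypic components of W, and irr_comp gives the isomorphism type of the   *)
(* simple module underlying M.                                                *)
Definition irr_mult W (i : sG) : nat :=
  \sum_(M : DecSocleType W | irr_comp sG (socle_repr M) == i) socle_mult M.

Lemma irr_mult_decomp W :
    [pchar F]^'.-group G ->
  mx_rsim W (\big[@dadd_grepr F gT G/@grepr0 F gT G]_(i : sG)
               muln_grepr (irr_grepr i) (irr_mult W i)).
Proof.
move=> F'G; pose tW := DecSocleType W.
pose type (M : tW) : sG := irr_comp sG (socle_repr M).
have typeP (M : tW) : mx_rsim (socle_repr M) (irr_repr (type M)).
  exact: rsim_irr_comp_pchar (socle_irr M).
have type_inj : injective type.
  move=> M N eqMN; apply/eqP/socle_rsimP.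
  by apply: mx_rsim_trans (typeP M) (mx_rsim_sym _); rewrite eqMN.
pose comp i := [pick M | type M == i].
have compK M : comp (type M) = Some M.
  rewrite /comp; case: pickP => [N /eqP/type_inj-> //|/(_ M)].
  by rewrite eqxx.
have multE i : irr_mult W i = oapp (@socle_mult _ _ _ _ _ tW) 0%N (comp i).
  rewrite /irr_mult /comp; case: pickP => [M /eqP typeM | no_M] /=.
    by rewrite (big_pred1 M) // => N; rewrite -typeM (inj_eq type_inj).
  by rewrite big_pred0.
pose U i : 'M_(rdegree W) := oapp (fun M : tW => M : 'M_(rdegree W)) 0 (comp i).
have modU i : mxmodule W (U i).
  rewrite /U; case: (comp i) => [M|] /=; last exact: mxmodule0.
  exact: component_mx_module.
have [defU dxU] : (\sum_i U i :=: 1%:M)%MS /\ mxdirect (\sum_i U i).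
  rewrite mxdirectE /= !(bigID comp xpredT) /=.
  rewrite addsmxC big1 => [|i]; last by rewrite /U; case: (comp i).
  rewrite adds0mx_id addnC (@big1 nat) ?add0n => [|i]; last first.
    by rewrite /U; case: (comp i); rewrite ?mxrank0.
  have <-: Socle tW = 1%:M := reducible_Socle1 tW (mx_Maschke_pchar W F'G).
  have [M0 _ | noM] := pickP tW; last first.
    suff no_i: (comp : pred sG) =1 xpred0.
      by rewrite /Socle !big_pred0 ?mxrank0.
    by move=> i; rewrite /comp; case: pickP => // M; have:= noM M.
  have bij_type: {on [pred i | comp i], bijective type}.
    exists (odflt M0 \o comp) => [M _ | i]; first by rewrite /= compK.
    by rewrite inE /comp /=; case: pickP => //= M; move/eqP.
  rewrite !(reindex type) {bij_type}//=.
  have all_comp M : comp (type M) by rewrite compK.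
  rewrite (eq_bigr val) => [|M _]; last by rewrite /U compK.
  rewrite !(eq_bigl _ _ all_comp); split=> //.
  rewrite (eq_bigr (mxrank \o val)) => [|M _]; last by rewrite /U compK.
  by rewrite -mxdirectE /= Socle_direct.
apply: mx_rsim_trans (mx_rsim_sym (rsim_submod1 (mxmodule1 W) _)) _ => //.
under eq_bigr do rewrite multE.
apply: mx_rsim_dsum (modU) _ defU dxU _ => i.
move: (modU i); rewrite /U /comp; case: pickP => [M /eqP<-|_] /= modUi; last first.
  rewrite /muln_grepr big_ord0.
  by exists 0 => [||x _]; rewrite /row_free ?mxrank0 ?mulmx0 ?mul0mx.
rewrite (bool_irrelevance modUi (component_mx_module W (socle_base M))).
exact: (@mx_rsim_socle _ _ _ _ _ _ M (irr_grepr (type M)) (typeP M)).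
Qed.

(* Entry (i, j) counts the arrows from i to j.                                *)
Definition McKay_adj V : 'M[nat]_#|sG| :=
  \matrix_(i, j) irr_mult (tens_grepr (irr_grepr (enum_val i)) V) (enum_val j).

End McKay.

(* Main.v *)
Require Import Defs.
From HB Require Import structures.
From mathcomp Require Import all_boot all_order all_algebra all_fingroup.
From mathcomp Require Import all_solvable all_field all_character.
From mathcomp Require Import complex.
From mathcomp Require Import reals.

Set Implicit Arguments.
Unset Strict Implicit.
Unset Printing Implicit Defensive.

Import GroupScope GRing.Theory Num.Theory.
Local Open Scope ring_scope.

(* Averaging over G projects Hom(U, W) onto Hom_G(U, W), so the dimension of  *)
(* the latter is the trace |G|^-1 sum_g chi_U(g^-1) chi_W(g) of the projector. *)
(* Decomposing G_nu (x) V repeatedly gives, by induction on k,                *)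
(*   chi_V^k = sum_lam (A^k)_(0, lam) chi_lam,                                *)
(* and by Schur's lemma dim Hom_G(G_lam, V^{(x)k}) picks out the coefficient  *)
(* (A^k)_(0, lam).                                                            *)

(** Every dimension in the statement is that of a Hom space or of a fixed space, hence by [dim_homG]
    and [rank_rfix_mx] a mean of character values over [G]. The invariants of a tensor power and the
    Hom space from the trivial module have the same mean, which gives (ii) from (i). For (iii),
    self-duality turns chi_V(g^-1)^k chi_V(g)^k into chi_V(g)^(2k). [rchar_conj] replaces chi(g^-1)
    by the conjugate of chi(g), and [sum_classes] groups the sums by conjugacy classes. The powers
    of the McKay matrix enter through [dim_Zk_irr]. Equalities between natural numbers are proved
    after casting to the field, which loses nothing in characteristic 0. *)

Lemma mxtrace_idem (F : fieldType) n (P : 'M[F]_n) :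
  P *m P = P -> \tr P = (\rank P)%:R.
Proof.
move: (mulmx_base P) (col_base_full P) (row_base_free P).
move: (\rank P) (col_base P) (row_base P) => r C R <- fullC freeR CRCR.
(* In the rank factorization [C *m R], [C] cancels on the left and [R] on the right, so idempotence
   reduces to [R *m C = 1%:M]. *)
rewrite mxtrace_mulC; suff -> : R *m C = 1%:M by rewrite mxtrace1.
have [L LC] := row_fullP fullC; have [L' RL] := row_freeP freeR.
have := congr1 (fun X => L *m X *m L') CRCR.
by rewrite /= !mulmxA LC !mul1mx -mulmxA RL mulmx1.
Qed.

(** Bridge between the two encodings of subspaces: [homG] is a [{vspace _}] of matrices, whereas
    fixed spaces of representations are row spaces. *)
Lemma dim_mxvec_sub (F : fieldType) m n p (U : {vspace 'M[F]_(m, n)})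
    (A : 'M[F]_(p, m * n)) :
  (forall X, (X \in U) = (mxvec X <= A)%MS) -> \dim U = \rank A.
Proof.
move=> UA; pose f := linfun (vec_mx \o @mulmxr _ 1 _ _ (row_base A)).
have fE u : f u = vec_mx (u *m row_base A) by rewrite lfunE.
have kerf : lker f == 0%VS.
  apply/lker0P => u v; rewrite !fE => /(can_inj vec_mxK).
  exact/row_free_inj/row_base_free.
have -> : U = limg f.
  apply/vspaceP => X; rewrite UA -(eq_row_base A).
  apply/submxP/memv_imgP => [[u Xu] | [u _ ->]]; exists u; rewrite ?memvf //.
    by rewrite fE -Xu mxvecK.
  by rewrite fE vec_mxK.
rewrite limg_dim_eq ?dimvf ?dim_matrix; first exact: mul1n.
by rewrite (eqP kerf) capv0.
Qed.

(** In the basis of elementary matrices, the diagonal coefficient at [(i, j)] is [A i i * B j j]. *)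
Lemma mxtrace_lin_mulmx (F : fieldType) m n (A : 'M[F]_m)
    (B : 'M[F]_n) :
  \tr (lin_mx (mulmx A \o mulmxr B)) = \tr A * \tr B.
Proof.
rewrite /mxtrace big_distrlr /= pair_big /=.
rewrite (reindex _ (curry_mxvec_bij m n)) /=.
apply: eq_bigr => -[i j] _ /=.
rewrite mxE /= mxvecE vec_mx_delta -(mul_delta_mx (0 : 'I_1)) -mulmxA mulmxA.
by rewrite -colE -rowE mxE big_ord1 !mxE.
Qed.

(** * Dimensions of Hom spaces as means of characters *)

Section HomDimension.

Variables (F : fieldType) (gT : finGroupType) (G : {group gT}).
Hypothesis F'G : [pchar F]^'.-group G.
Implicit Types U V W : representation F G.

(** The mean [P] of the [rW g] is a projector onto the fixed space, so its trace is its rank. *)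
Lemma rank_rfix_mx n (rW : mx_representation F G n) :
  (\rank (rfix_mx rW G))%:R = #|G|%:R^-1 * \sum_(g in G) \tr (rW g).
Proof.
have nzG : #|G|%:R != 0 :> F by rewrite natf_neq0_pchar.
pose P := #|G|%:R^-1 *: \sum_(g in G) rW g.
have PW : {in G, forall h, P *m rW h = P}.
  move=> h Gh; rewrite -scalemxAl mulmx_suml; congr (_ *: _).
  rewrite [RHS](reindex_inj (mulIg h)) /=; apply: eq_big => [g|g Gg].
    by rewrite groupMr.
  by rewrite repr_mxM.
have fixP m (X : 'M_(m, n)) : {in G, forall h, X *m rW h = X} -> X *m P = X.
  move=> XW; rewrite -scalemxAr mulmx_sumr (eq_bigr (fun=> X)) //.
  by rewrite sumr_const -scaler_nat scalerA mulVf ?scale1r.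
have -> : \rank (rfix_mx rW G) = \rank P.
  apply/eqmx_rank/andP; split; last exact/rfix_mxP/PW.
  have <- : rfix_mx rW G *m P = rfix_mx rW G.
    by apply: fixP => h; apply: rfix_mx_id.
  exact: submxMl.
by rewrite -mxtrace_idem ?fixP // mxtraceZ raddf_sum.
Qed.

(** The conjugation action on Hom(U, W), whose fixed points are the [G]-homomorphisms. *)
Lemma hom_mx_repr U W :
  mx_repr G (fun g => lin_mx (mulmx (U g^-1%g) \o mulmxr (W g))).
Proof.
split=> [|g h Gg Gh]; apply/row_matrixP => i.
  by rewrite !rowE mul_rV_lin /= invg1 !repr_mx1 !mulmx1 mul1mx vec_mxK.
rewrite !rowE mulmxA !mul_rV_lin /=.
by rewrite mxvecK invMg !repr_mxM ?groupV // !mulmxA.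
Qed.

Lemma dim_homG U W :
  (\dim (homG U W))%:R
    = #|G|%:R^-1 * \sum_(g in G) rchar U g^-1%g * rchar W g.
Proof.
pose H := MxRepresentation (hom_mx_repr U W).
rewrite (@dim_mxvec_sub _ _ _ _ _ (rfix_mx H G)) => [|X].
  by rewrite rank_rfix_mx; under eq_bigr do rewrite mxtrace_lin_mulmx.
apply/homGP/rfix_mxP => fixX g Gg.
  rewrite mul_vec_lin /= -fixX // mulmxA.
  by rewrite -repr_mxM ?groupV // mulVg repr_mx1 mul1mx.
have /(congr1 vec_mx) := fixX g Gg; rewrite mx_vec_lin mxvecK /= => {1}<-.
by rewrite mulmxA -repr_mxM ?groupV // mulgV repr_mx1 mul1mx.
Qed.

Lemma rchar_rsim V W : mx_rsim V W -> {in G, rchar V =1 rchar W}.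
Proof. by move=> simVW g Gg; apply: mxtrace_rsim Gg. Qed.

Lemma rchar1 g : rchar (triv_grepr F G) g = 1.
Proof. by rewrite /rchar mxtrace1. Qed.

Lemma rcharM V W g : rchar (tens_grepr V W) g = rchar V g * rchar W g.
Proof. exact: mxtrace_prod. Qed.

Lemma rcharX V k g : rchar (tpow_grepr V k) g = rchar V g ^+ k.
Proof. by elim: k => [|k IHk]; rewrite ?rchar1 // rcharM IHk exprSr. Qed.

Lemma rcharJ V : {in G &, forall g h, rchar V (g ^ h)%g = rchar V g}.
Proof.
move=> g h Gg Gh; rewrite /rchar conjgE !repr_mxM ?groupM ?groupV //.
by rewrite mxtrace_mulC repr_mxK.
Qed.

Lemma rchar_dual V g : rchar (dual_grepr V) g = rchar V g^-1%g.
Proof. exact: mxtrace_tr. Qed.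

Lemma rchar_dadd V W g :
  rchar (dadd_grepr V W) g = rchar V g + rchar W g.
Proof. exact: mxtrace_block. Qed.

Lemma rchar_dsum (I : Type) (r : seq I) (P : pred I)
    (W : I -> representation F G) g :
  rchar (\big[@dadd_grepr F gT G/@grepr0 F gT G]_(i <- r | P i) W i) g
    = \sum_(i <- r | P i) rchar (W i) g.
Proof.
apply: (big_morph (fun W => rchar W g)) => [V1 V2|]; first exact: rchar_dadd.
by rewrite /rchar /mxtrace big_ord0.
Qed.

Lemma rchar_muln V m g : rchar (muln_grepr V m) g = rchar V g *+ m.
Proof. by rewrite rchar_dsum sumr_const card_ord. Qed.

Lemma homG_gring_op U W X A : X \in homG U W -> (A \in group_ring F G)%MS ->
  gring_op U A *m X = X *m gring_op W A.
Proof.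
move=> /homGP homX /envelop_mxP[a ->].
rewrite 2!linear_sum mulmx_suml mulmx_sumr; apply: eq_bigr => g Gg.
by rewrite 2!linearZ /= !gring_opG // -scalemxAl homX // -scalemxAr.
Qed.

(** The Wedderburn idempotent of [j] acts as 1 on the module of [j] and as 0 on that of [i]; an
    intertwiner commutes with it, hence vanishes. *)
Lemma homG_irr_eq0 (sG : irrType F G) (i j : sG) :
  i != j -> homG (irr_grepr i) (irr_grepr j) = 0%VS.
Proof.
move=> neq_ij; apply/eqP; rewrite -subv0; apply/subvP => X homX; rewrite memv0.
have Ge : (Wedderburn_id j \in group_ring F G)%MS.
  by rewrite -(Wedderburn_sum_pchar sG F'G) (sumsmx_sup j) ?Wedderburn_id_mem.
have /= := homG_gring_op homX Ge; rewrite op_Wedderburn_id_pchar // mulmx1 => <-.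
by rewrite (irr_repr'_op0_pchar _ _ (Wedderburn_id_mem j)) ?mul0mx // eq_sym.
Qed.

Lemma dim_homG_irr (sG : irrType F G) (i j : sG) :
  group_splitting_field F G ->
  \dim (homG (irr_grepr i) (irr_grepr j)) = (i == j).
Proof.
move=> splitG; have [<-|neq_ij] := eqVneq; last first.
  by rewrite homG_irr_eq0 ?dimv0.
suff -> : homG (irr_grepr i) (irr_grepr i) = <[1%:M]>%VS.
  by rewrite dim_vline -mxrank_eq0 mxrank1 -lt0n irr_degree_gt0.
apply/vspaceP => X; apply/homGP/vlineP => [cGX | [a ->] g Gg].
  have /is_scalar_mxP[a ->] : is_scalar_mx X.
    apply: (mx_abs_irr_cent_scalar (splitG _ _ (socle_irr i))).
    by apply/centgmxP => g /cGX.
  by exists a; rewrite scalemx1.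
by rewrite scalemx1 scalar_mxC.
Qed.

End HomDimension.

Lemma sum_classes (F : nzRingType) (gT : finGroupType) (G : {group gT})
    (I : finType) (cl : I -> {set gT}) (c : I -> gT) (f : gT -> F) :
    injective cl -> [set cl i | i : I] = classes G ->
    (forall i, c i \in cl i) -> {in G &, forall g h, f (g ^ h)%g = f g} ->
  \sum_i #|cl i|%:R * f (c i) = \sum_(g in G) f g.
Proof.
move=> cl_inj clG c_cl fJ; rewrite (set_partition_big _ (classes_partition G)) /=.
rewrite -clG big_imset /=; last by move=> i j _ _ /cl_inj.
apply: eq_bigr => i _; have /imsetP[x Gx defcl] : cl i \in classes G.
  by rewrite -clG imset_f.
have fE g : g \in cl i -> f g = f x.
  by rewrite defcl => /imsetP[h Gh ->]; apply: fJ.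
by rewrite (eq_bigr (fun=> f x)) ?fE // sumr_const mulr_natl.
Qed.

(** * Complex characters and powers of the McKay matrix *)

Section McKayCharacters.

Variables (F : numClosedFieldType) (gT : finGroupType) (G : {group gT}).
Implicit Types V W : representation F G.

Lemma pchar_num_pgroup : [pchar F]^'.-group G.
Proof. by apply/pgroupP => p _ _; rewrite inE /= pchar_num. Qed.

(* [V] preserves the positive definite form averaged over [G], so that [V g^-1]
   is similar to the conjugate transpose of [V g].                            *)
Lemma rchar_conj V : {in G, forall g, rchar V g^-1%g = (rchar V g)^*}.
Proof.
move=> g Gg; pose adj m n (X : 'M[F]_(m, n)) := (map_mx Num.conj X)^T.
have adjM m n p (X : 'M_(m, n)) (Y : 'M_(n, p)) :
  adj _ _ (X *m Y) = adj _ _ Y *m adj _ _ X.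
  by rewrite /adj map_mxM trmx_mul.
pose H := \sum_(h in G) V h *m adj _ _ (V h).
have HV : V g *m H *m adj _ _ (V g) = H.
  rewrite mulmx_sumr mulmx_suml [RHS](reindex_inj (mulgI g)) /=.
  apply: eq_big => [h|h Gh]; first by rewrite groupMl.
  by rewrite repr_mxM // adjM !mulmxA.
(* If [u *m H = 0], pairing with [u] gives a vanishing sum of the squared norms of all [u *m V h];
   the term at [h = 1] forces [u = 0]. *)
have uH : H \in unitmx.
  rewrite -row_free_unit -kermx_eq0; apply/rowV0P => u /sub_kermxP uH0.
  have : \sum_(h in G) \sum_i `|(u *m V h) 0 i| ^+ 2 = 0.
    transitivity ((u *m H *m adj _ _ u) 0 0); last by rewrite uH0 mul0mx mxE.
    rewrite mulmx_sumr mulmx_suml summxE; apply: eq_bigr => h _.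
    rewrite mulmxA -mulmxA -adjM mxE; apply: eq_bigr => i _.
    by rewrite !mxE normCK.
  move/eqP; rewrite psumr_eq0 => [/allP/(_ 1%g (mem_index_enum _))|h _];
    last first.
    by apply: sumr_ge0 => i _; apply: exprn_ge0.
  rewrite group1 repr_mx1 mulmx1 /= psumr_eq0 => [/allP u0|i _]; last first.
    exact: exprn_ge0.
  apply/rowP => i; have := u0 i (mem_index_enum _).
  by rewrite /= sqrf_eq0 normr_eq0 mxE => /eqP.
rewrite /rchar; have -> : V g^-1%g = H *m adj _ _ (V g) *m invmx H.
  apply: (canRL (mulmxK uH)); rewrite -[in LHS]HV !mulmxA -repr_mxM ?groupV //.
  by rewrite mulVg repr_mx1 mul1mx.
rewrite mxtrace_mulC mulKmx // mxtrace_tr.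
by rewrite /mxtrace rmorph_sum; apply: eq_bigr => i _; rewrite mxE.
Qed.

Variable sG : irrType F G.

Lemma rchar_irr1 g : g \in G -> rchar (irr_grepr ([1 sG]%irr)) g = 1.
Proof. by move=> Gg; rewrite /rchar /= irr1_repr // mxtrace1 degree_irr1. Qed.

Lemma rchar_irr_mult W : {in G, forall g,
  rchar W g = \sum_(i : sG) (irr_mult W i)%:R * rchar (irr_grepr i) g}.
Proof.
move=> g Gg; have simW := @irr_mult_decomp _ _ _ sG W pchar_num_pgroup.
rewrite (rchar_rsim simW Gg) rchar_dsum; apply: eq_bigr => i _.
by rewrite rchar_muln mulr_natl.
Qed.

Lemma rcharX_McKay V k : {in G, forall g, rchar V g ^+ k
  = \sum_(i : sG)
      ((McKay_adj sG V ^+ k) (enum_rank [1 sG]%irr) (enum_rank i))%:R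
      * rchar (irr_grepr i) g}.
Proof.
move=> g Gg; elim: k => [|k IHk].
  rewrite !expr0 (bigD1 [1 sG]%irr) //= big1 => [|i ne_i1].
    by rewrite mxE eqxx mul1r addr0 rchar_irr1.
  by rewrite mxE (inj_eq enum_rank_inj) eq_sym (negPf ne_i1) mul0r.
rewrite exprSr IHk mulr_suml.
(* The product of chi_j with chi_V is the character of the tensor product, whose multiplicities form
   row j of the McKay matrix; exchanging the sums yields the matrix product. *)
under eq_bigr do rewrite -mulrA -rcharM (rchar_irr_mult _ Gg) mulr_sumr.
rewrite exchange_big; apply: eq_bigr => i _ /=.
rewrite exprSr mxE natr_sum mulr_suml.
rewrite [RHS](reindex _ (onW_bij _ (@enum_rank_bij sG))) /=.
by apply: eq_bigr => j _; rewrite mxE !enum_rankK natrM mulrA.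
Qed.

Lemma dim_Zk_irr V k (i : sG) :
  \dim (Zk_irr V k i)
    = (McKay_adj sG V ^+ k) (enum_rank [1 sG]%irr) (enum_rank i).
Proof.
have F'G := pchar_num_pgroup.
have splitG := @group_closure_closed_field F gT G.
pose a j := (McKay_adj sG V ^+ k) (enum_rank [1 sG]%irr) (enum_rank j).
apply/eqP; rewrite -(eqr_nat F) dim_homG //; apply/eqP.
under eq_bigr => g Gg do rewrite rcharX (rcharX_McKay _ _ Gg) mulr_sumr.
rewrite exchange_big mulr_sumr /=.
rewrite (eq_bigr (fun j => (a j)%:R * (i == j)%:R)) => [|j _].
  rewrite (bigD1 i) //= eqxx mulr1 big1 ?addr0 // => j.
  by rewrite eq_sym => /negPf->; rewrite mulr0.
(* Orthogonality of irreducible characters: Schur's lemma read through [dim_homG]. *)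
rewrite -dim_homG_irr // dim_homG // mulrCA; congr (_ * _).
by rewrite mulr_sumr; apply: eq_bigr => g _; rewrite mulrCA.
Qed.

End McKayCharacters.

Theorem corollary2p5 (R : realType) (gT : finGroupType) (G : {group gT})
    (sG : irrType R[i] G) (cl : sG -> {set gT}) (c : sG -> gT)
    (cl_inj : injective cl) (cl_classes : [set cl mu | mu : sG] = classes G)
    (c_cl : forall mu : sG, c mu \in cl mu)
    (V : representation R[i] G) (k : nat) :
  let A := McKay_adj sG V in
  let i0 : 'I_#|sG| := enum_rank [1 sG]%irr in
  [/\ forall lam : sG,
        [/\ \dim (Zk_irr V k lam) = (A ^+ k) i0 (enum_rank lam),
            ((A ^+ k) i0 (enum_rank lam))%:R
              = #|G|%:R^-1 * \sum_(mu : sG) #|cl mu|%:R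
                  * rchar V (c mu) ^+ k * (rchar (irr_grepr lam) (c mu))^*
          & #|G|%:R^-1 * \sum_(mu : sG) #|cl mu|%:R
                * rchar V (c mu) ^+ k * (rchar (irr_grepr lam) (c mu))^*
              = #|G|%:R^-1 * \sum_(g in G)
                  rchar V g ^+ k * (rchar (irr_grepr lam) g)^*],
      [/\ \rank (rfix_mx (tpow_grepr V k) G) = (A ^+ k) i0 i0,
          ((A ^+ k) i0 i0)%:R
            = #|G|%:R^-1 * \sum_(mu : sG) #|cl mu|%:R * rchar V (c mu) ^+ k
        & #|G|%:R^-1 * \sum_(mu : sG) #|cl mu|%:R * rchar V (c mu) ^+ k
            = #|G|%:R^-1 * \sum_(g in G) rchar V g ^+ k]
    & self_dual V ->
      [/\ \dim (Zk V k) = \dim (Zk_irr V (2 * k) [1 sG]%irr),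
          \dim (Zk_irr V (2 * k) [1 sG]%irr) = (A ^+ (2 * k)) i0 i0,
          ((A ^+ (2 * k)) i0 i0)%:R
            = #|G|%:R^-1
                * \sum_(mu : sG) #|cl mu|%:R * rchar V (c mu) ^+ (2 * k)
        & #|G|%:R^-1 * \sum_(mu : sG) #|cl mu|%:R * rchar V (c mu) ^+ (2 * k)
            = #|G|%:R^-1 * \sum_(g in G) rchar V g ^+ (2 * k)]].
Proof.
move=> A i0; have F'G := pchar_num_pgroup R[i] G.
have sum_cl f : {in G &, forall g h, f (g ^ h)%g = f g} ->
    \sum_(mu : sG) #|cl mu|%:R * f (c mu) = \sum_(g in G) f g :> R[i].
  exact: sum_classes.
have sum_clX m : \sum_(mu : sG) #|cl mu|%:R * rchar V (c mu) ^+ m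
    = \sum_(g in G) rchar V g ^+ m.
  by apply: (sum_cl (fun g => rchar V g ^+ m)) => g h Gg Gh; rewrite rcharJ.
have inv_num m : (\rank (rfix_mx (tpow_grepr V m) G))%:R
    = #|G|%:R^-1 * \sum_(g in G) rchar V g ^+ m.
  rewrite rank_rfix_mx //; congr (_ * _).
  by apply: eq_bigr => g _; rewrite -rcharX.
have dimZ m (lam : sG) : (\dim (Zk_irr V m lam))%:R
    = #|G|%:R^-1 * \sum_(g in G) rchar V g ^+ m * (rchar (irr_grepr lam) g)^*.
  rewrite dim_homG //; congr (_ * _); apply: eq_bigr => g Gg.
  by rewrite rchar_conj // rcharX mulrC.
have dimZ0 m : (\dim (Zk_irr V m [1 sG]%irr))%:R
    = #|G|%:R^-1 * \sum_(g in G) rchar V g ^+ m.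
  rewrite dimZ; congr (_ * _); apply: eq_bigr => g Gg.
  by rewrite rchar_irr1 // rmorph1 mulr1.
have powA m lam : (A ^+ m) i0 (enum_rank lam) = \dim (Zk_irr V m lam).
  exact/esym/dim_Zk_irr.
have powA0 m : (A ^+ m) i0 i0 = \dim (Zk_irr V m [1 sG]%irr) by apply: powA.
split=> [lam | | sdV].
- have sum_lam : \sum_(mu : sG) #|cl mu|%:R * rchar V (c mu) ^+ k
                     * (rchar (irr_grepr lam) (c mu))^*
      = \sum_(g in G) rchar V g ^+ k * (rchar (irr_grepr lam) g)^*.
    under eq_bigr do rewrite -mulrA.
    apply: (sum_cl (fun g => rchar V g ^+ k * (rchar (irr_grepr lam) g)^*)).
    by move=> g h Gg Gh; rewrite !rcharJ.
  by split; rewrite ?sum_lam ?powA.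
- split; rewrite ?sum_clX ?powA0 ?dimZ0 //.
  by apply/eqP; rewrite -(eqr_nat R[i]) inv_num dimZ0.
split; rewrite ?sum_clX ?powA0 ?dimZ0 //.
apply/eqP; rewrite -(eqr_nat R[i]) dimZ0 dim_homG //; apply/eqP.
congr (_ * _); apply: eq_bigr => g Gg.
(* The value at the inverse is the dual character at [g], hence chi_V(g) by self-duality. *)
by rewrite !rcharX -rchar_dual -(rchar_rsim sdV Gg) mul2n -addnn exprD.
Qed.
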